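(* Let $n\ge1$, let $Q,B\in M_n(\mathbb{R})$ with $Q$ symmetric positive semi-definite, and assume that the Ornstein-Uhlenbeck operator $P=\frac12\mathrm{Tr}(Q\nabla_x^2)+\langle Bx,\nabla_x\rangle$ on $\mathbb{R}^n$ is hypoelliptic and admits an invariant measure, i.e. that $\mathrm{Rank}[Q^{1/2},BQ^{1/2},\dots,B^{n-1}Q^{1/2}]=n$ and $\sigma(B)\subset\{z\in\mathbb{C}:\mathrm{Re}\,z<0\}$. Let $Q_\infty=\int_0^{+\infty}e^{sB}Qe^{sB^T}ds$. Then the singular space $$S=\Big(\bigcap_{j=0}^{2n-1}\mathrm{Ker}\big[\mathrm{Re}\,F\,(\mathrm{Im}\,F)^j\big]\Big)\cap\mathbb{R}^{2n}$$ of the quadratic form $$q(x,\xi)=\tfrac12|Q^{1/2}\xi|^2+\tfrac18|Q^{1/2}Q_\infty^{-1}x|^2-i\Big\langle\Big(\tfrac12QQ_\infty^{-1}+B\Big)x,\xi\Big\rangle,\quad (x,\xi)\in\mathbb{R}^{2n},$$ is equal to zero: $S=\{0\}$. Here $F\in M_{2n}(\mathbb{C})$ is the Hamilton map of $q$.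
   Context: The Hamilton map $F\in M_{2n}(\mathbb{C})$ of a complex-valued quadratic form $q$ on $\mathbb{R}^{2n}$ is the unique matrix with $q((x,\xi);(y,\eta))=\sigma((x,\xi),F(y,\eta))$ for all $(x,\xi),(y,\eta)\in\mathbb{R}^{2n}$, where $q(\cdot;\cdot)$ is the polarized (symmetric bilinear) form of $q$ and $\sigma((x,\xi),(y,\eta))=\langle\xi,y\rangle-\langle x,\eta\rangle$. $\mathrm{Re}\,F=\frac12(F+\overline F)$ and $\mathrm{Im}\,F=\frac1{2i}(F-\overline F)$ are the entrywise real and imaginary parts. For the form $q$ of the statement, $$F=\begin{pmatrix}-\frac i4(QQ_\infty^{-1}+2B)&\frac12Q\\-\frac18Q_\infty^{-1}QQ_\infty^{-1}&\frac i4(QQ_\infty^{-1}+2B)^T\end{pmatrix}.$$ Under the assumptions $Q_\infty$ is symmetric positive definite. The equivalence of hypoellipticity with the Kalman rank condition and of existence of an invariant measure with the spectral condition on $B$ are known facts. *)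

(* Defs.v *)
From HB Require Import structures.
From mathcomp Require Import all_boot all_order all_algebra.
From mathcomp Require Import all_classical all_reals all_analysis.
From mathcomp Require Import complex.

Set Implicit Arguments.
Unset Strict Implicit.
Unset Printing Implicit Defensive.

Import Order.TTheory GRing.Theory Num.Theory.
Import numFieldNormedType.Exports.

Local Open Scope classical_set_scope.
Local Open Scope complex_scope.
Local Open Scope ring_scope.

(* The bilinear product [\sum_i u_i v_i]: the Euclidean inner product over the
   reals, and its C-bilinear (not sesquilinear) extension over [R[i]].  Note
   that the norm [`|u|] of the library on matrices is the sup norm. *)
Definition inner (K : comPzRingType) (n : nat) (u v : 'cV[K]_n) : K :=
  \sum_i u i ord0 * v i ord0.

Definition complexify (R : realType) (m n : nat) (A : 'M[R]_(m, n)) :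
    'M[R[i]]_(m, n) :=
  map_mx (fun x => x%:C) A.

Definition sym_psd (R : realType) (n : nat) (A : 'M[R]_n) : Prop :=
  A^T = A /\ forall v : 'cV[R]_n, 0 <= inner v (A *m v).

(* Definite description: a symmetric positive semi-definite matrix has exactly
   one symmetric positive semi-definite square root. *)
Definition sqrt_mx (R : realType) (n : nat) (A : 'M[R]_n) : 'M[R]_n :=
  xget 0 [set S : 'M[R]_n | sym_psd S /\ S *m S = A].

Definition exp_mx (R : realType) (n : nat) (A : 'M[R]_n) : 'M[R]_n :=
  limn (series (fun k : nat => (k`!%:R : R)^-1 *: A ^+ k)).

(* Hypoellipticity of [1/2 Tr(Q nabla^2) + <Bx, nabla>]. *)
Definition kalman_rank (R : realType) (n : nat) (Q B : 'M[R]_n) : Prop :=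
  \rank (\mxrow_(j < n) (B ^+ j *m sqrt_mx Q)) = n.

(* Existence of an invariant measure for the same operator. *)
Definition spectrum_in_left_half_plane (R : realType) (n : nat)
    (B : 'M[R]_n) : Prop :=
  forall z : R[i], eigenvalue (complexify B) z -> complex.Re z < 0.

Definition Q_infty (R : realType) (n : nat) (Q B : 'M[R]_n) : 'M[R]_n :=
  \matrix_(i, j)
    \int[@lebesgue_measure R]_(s in `[0, +oo[)
      ((exp_mx (s *: B) *m Q *m exp_mx (s *: B^T)) i j).

(* A point [(x, xi)] of phase space is the column [col_mx x xi]. *)
Definition symplectic (K : comPzRingType) (n : nat)
    (X Y : 'cV[K]_(n + n)) : K :=
  inner (dsubmx X) (usubmx Y) - inner (usubmx X) (dsubmx Y).

Definition polar (R : realType) (m : nat) (q : 'cV[R]_m -> R[i])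
    (X Y : 'cV[R]_m) : R[i] :=
  4^-1 * (q (X + Y) - q (X - Y)).

(* Definite description: the symplectic form being nondegenerate, a quadratic
   form has exactly one Hamilton map. *)
Definition hamilton_map (R : realType) (n : nat)
    (q : 'cV[R]_(n + n) -> R[i]) : 'M[R[i]]_(n + n) :=
  xget 0 [set F : 'M[R[i]]_(n + n) | forall X Y : 'cV[R]_(n + n),
    polar q X Y = symplectic (complexify X) (F *m complexify Y)].

Definition Re_mx (R : realType) (n : nat) (F : 'M[R[i]]_n) : 'M[R[i]]_n :=
  map_mx (fun z => 'Re z) F.

Definition Im_mx (R : realType) (n : nat) (F : 'M[R[i]]_n) : 'M[R[i]]_n :=
  map_mx (fun z => 'Im z) F.

(* The kernels are subspaces of C^(2n); the intersection with R^(2n) is taken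
   as the preimage under the embedding of R^(2n) into C^(2n). *)
Definition singular_space (R : realType) (n : nat)
    (q : 'cV[R]_(n + n) -> R[i]) : set 'cV[R]_(n + n) :=
  let F := hamilton_map q in
  @complexify R (n + n) 1 @^-1`
    (\bigcap_(j < n + n)
       [set Z : 'cV[R[i]]_(n + n) | Re_mx F *m Im_mx F ^+ j *m Z = 0]).

Definition OU_form (R : realType) (n : nat) (Q B : 'M[R]_n)
    (X : 'cV[R]_(n + n)) : R[i] :=
  let x := usubmx X in
  let xi := dsubmx X in
  let Qh := sqrt_mx Q in
  let Qi := invmx (Q_infty Q B) in
  (2^-1 * inner (Qh *m xi) (Qh *m xi)
   + 8^-1 * inner (Qh *m Qi *m x) (Qh *m Qi *m x))%:C
  - 'i * (inner ((2^-1 *: (Q *m Qi) + B) *m x) xi)%:C.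

(* Main.v *)
Require Import Defs.
From mathcomp Require Import all_boot all_order all_algebra.
From mathcomp Require Import all_classical all_reals all_analysis.
From mathcomp Require Import complex.
From mathcomp Require Import measurable_realfun ring lra.
Import Order.TTheory GRing.Theory Num.Theory.
Import numFieldNormedType.Exports.
Local Open Scope classical_set_scope.
Local Open Scope ring_scope.

Set Implicit Arguments.
Unset Strict Implicit.
Unset Printing Implicit Defensive.

(** With [K = Q_infty^-1] and [A = (B^T + K Q / 2) / 2], the Hamilton map is explicit:
    [Im F] is block diagonal with blocks [- A'] and [A], where [A' = (B + Q K / 2) / 2 = A^T],
    and [Re F] exchanges the two factors through [Q / 2] and [- K Q K / 8].  The Lyapunov
    equation [B Q_infty + Q_infty B^T = - Q] gives [K (- A') = A K], so a point [(x, xi)]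
    of the singular space satisfies [Q A^j xi = 0] and [Q A^j (K x) = 0] for [j < n].
    The term [K Q / 2] of [A] factors through [Q] and can be dropped, so the Kalman
    condition gives [xi = 0] and [K x = 0].

    For the Lyapunov equation: Schur triangularization of [B] provides a quadratic
    Lyapunov function, hence [exp (s B) -> 0].  As [exp (s B) X exp (s B)^T] is constant when
    [B X + X B^T = 0], the map [X |-> B X + X B^T] is injective, hence bijective, and
    the solution [X] for the right-hand side [- Q] satisfies
    [d/ds (exp (s B) X exp (s B)^T) = - exp (s B) Q exp (s B)^T], whence [X = Q_infty].
    Its kernel is [B^T]-invariant and contained in the kernel of [Q], hence zero. *)

Local Notation normc := Normc.normc.

(** * A quadratic Lyapunov function *)

(* The weights [d ^ 2i] make the strictly lower triangular part of a matrix as small as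
   wanted relative to the diagonal. *)
Lemma weighted_trig_bound (R : realType) (n : nat) (M c : R) (N : 'I_n -> R) (d : R) :
  0 <= M -> 0 < d <= 1 -> d * M * n%:R <= c -> (forall i, 0 <= N i) ->
  \sum_(i < n) \sum_(j < n | (j < i)%N) d ^+ i ^+ 2 * (M * (N i * N j)) <=
    c * \sum_(i < n) d ^+ i ^+ 2 * N i ^+ 2.
Proof.
move=> M0 /andP[d0 d1] dMc N0.
pose s i := d ^+ nat_of_ord i * N i.
have s0 i : 0 <= s i by rewrite mulr_ge0 ?exprn_ge0 // ltW.
have amgm (x y : R) : x * y <= (x ^+ 2 + y ^+ 2) / 2.
  by have := sqr_ge0 (x - y); rewrite sqrrB => ?; lra.
have step : forall i j : 'I_n, (j < i)%N ->
  d ^+ i ^+ 2 * (M * (N i * N j)) <= d * M * ((s i ^+ 2 + s j ^+ 2) / 2).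
  move=> i j ji.
  (* Splitting the weight as [d ^+ i * d ^+ (i - j) * d ^+ j] leaves at least one spare factor [d],
     as [j < i]. *)
  have -> : d ^+ i ^+ 2 * (M * (N i * N j)) = d ^+ (i - j) * M * (s i * s j).
    rewrite /s -[X in d ^+ X ^+ 2](subnK (ltnW ji)) -[X in d ^+ X * N i](subnK (ltnW ji)).
    rewrite !exprD; ring.
  have h1 : d ^+ (i - j) <= d.
    by rewrite -[leRHS]expr1 ler_wiXn2l // ?(ltW d0) // subn_gt0.
  have h2 : s i * s j <= (s i ^+ 2 + s j ^+ 2) / 2 by exact: amgm.
  apply: ler_pM => //; first by rewrite mulr_ge0 ?exprn_ge0 // ltW.
    by rewrite mulr_ge0.
  by rewrite ler_wpM2r.
have sq i : d ^+ nat_of_ord i ^+ 2 * N i ^+ 2 = s i ^+ 2 by rewrite /s exprMn.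
under [X in _ <= c * X]eq_bigr do rewrite sq.
(* Enlarging to all pairs makes the double sum separate, at the price of a factor [n]. *)
apply: (@le_trans _ _ (\sum_(i < n) \sum_(j < n) d * M * ((s i ^+ 2 + s j ^+ 2) / 2))).
  apply: ler_sum => i _; rewrite [leRHS](bigID (fun j : 'I_n => (j < i)%N)) /=.
  rewrite -[leLHS]addr0 lerD //; first by apply: ler_sum => j; exact: step.
  apply: sumr_ge0 => j _; rewrite mulr_ge0 ?divr_ge0 ?addr_ge0 ?sqr_ge0 //.
  by rewrite mulr_ge0 // ltW.
have -> : \sum_(i < n) \sum_(j < n) d * M * ((s i ^+ 2 + s j ^+ 2) / 2) =
    d * M * n%:R * \sum_(i < n) s i ^+ 2.
  transitivity (\sum_(i < n) (d * M / 2 * (n%:R * s i ^+ 2) + d * M / 2 * \sum_(j < n) s j ^+ 2)).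
    apply: eq_bigr => i _; rewrite mulr_sumr.
    transitivity (\sum_(j < n) (d * M / 2 * s i ^+ 2 + d * M / 2 * s j ^+ 2)).
      by apply: eq_bigr => j _; field.
    rewrite big_split /= sumr_const card_ord -mulr_natl; congr (_ + _); ring.
  rewrite big_split /= sumr_const card_ord -!mulr_sumr -mulr_natl; by field.
by rewrite ler_wpM2r // sumr_ge0 // => i _; exact: sqr_ge0.
Qed.

Lemma ReD (R : realType) (x y : R[i]) :
  complex.Re (x + y) = complex.Re x + complex.Re y.
Proof. by case: x; case: y. Qed.

Lemma Re_sum (R : realType) (I : Type) (r : seq I) (P : pred I) (F : I -> R[i]) :
  complex.Re (\sum_(i <- r | P i) F i) = \sum_(i <- r | P i) complex.Re (F i).
Proof. by apply: (big_morph _ (@ReD R)). Qed.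

Lemma ReZl (R : realType) (a : R) (x : R[i]) :
  complex.Re (a%:C%C * x) = a * complex.Re x.
Proof. by case: x => x y /=; rewrite mul0r subr0. Qed.

Lemma normc_ge0 (R : realType) (z : R[i]) : 0 <= normc z.
Proof. by case: z => x y; exact: sqrtr_ge0. Qed.

Lemma Re_le_normc (R : realType) (z : R[i]) : complex.Re z <= normc z.
Proof.
case: z => x y /=; apply: le_trans (ler_norm x) _.
by rewrite -sqrtr_sqr ler_wsqrtr // lerDl sqr_ge0.
Qed.

Lemma normc_conj (R : realType) (z : R[i]) : normc (z^*)%C = normc z.
Proof. by case: z => x y /=; rewrite sqrrN. Qed.

Lemma mul_conjc_normc (R : realType) (z : R[i]) : (z^*)%C * z = (normc z ^+ 2)%:C%C.
Proof.
case: z => x y /=; rewrite sqr_sqrtr ?addr_ge0 ?sqr_ge0 //.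
apply/eqP; rewrite eq_complex /=; apply/andP; split; apply/eqP; ring.
Qed.

(** The diagonal gives decay at rate [2 * c]; geometric weights shrink the strictly lower triangular
    part until it costs at most [c]. *)
Lemma trig_dissipative (R : realType) (n : nat) (T : 'M[R[i]]_n) :
  is_trig_mx T -> (forall i, complex.Re (T i i) < 0) ->
  exists (w : 'I_n -> R) (m c : R),
    [/\ 0 < m, 0 < c, forall i, m <= w i &
      forall y : 'cV[R[i]]_n,
        complex.Re (\sum_i (w i)%:C%C * ((y i ord0)^*%C * (T *m y) i ord0)) <=
          - c * \sum_i w i * normc (y i ord0) ^+ 2].
Proof.
move=> /is_trig_mxP trT negT.
pose M : R := \sum_i \sum_j normc (T i j).
have TM i j : normc (T i j) <= M.
  rewrite /M (bigD1 i) //= (bigD1 j) //= -addrA lerDl addr_ge0 ?sumr_ge0 // => *;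
    by rewrite ?sumr_ge0 // => *; exact: normc_ge0.
have M0 : 0 <= M by rewrite !sumr_ge0 // => *; rewrite sumr_ge0 // => *; exact: normc_ge0.
have [c [c0 cT]] : exists c : R, 0 < c /\ forall i, complex.Re (T i i) <= - (2 * c).
  (* The inverse of [S] is a positive lower bound for all [- Re (T i i)]; the added [1] keeps [S]
     positive for an empty sum. *)
  pose S : R := \sum_i (- complex.Re (T i i))^-1 + 1.
  have inv0 i : 0 < (- complex.Re (T i i))^-1 by rewrite invr_gt0 oppr_gt0.
  have S0 : 0 < S by rewrite ltr_wpDl // sumr_ge0 // => i _; rewrite ltW.
  exists (S^-1 / 2); split; first by rewrite divr_gt0 ?invr_gt0.
  move=> i; have -> : 2 * (S^-1 / 2) = S^-1 by field; rewrite gt_eqF.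
  rewrite lerNr -[leRHS]invrK lef_pV2 ?posrE //.
  rewrite /S (bigD1 i) //= -addrA lerDl addr_ge0 ?sumr_ge0 // => j _.
  by rewrite ltW.
(* Small enough for [d * M * n <= c]; the [+ 1] keeps the denominator positive when [M = 0]. *)
pose d : R := Num.min 1 (c / (M * n%:R + 1)).
have D0 : 0 < M * n%:R + 1 by rewrite ltr_wpDl // mulr_ge0.
have d0 : 0 < d by rewrite lt_min ltr01 divr_gt0.
have d1 : d <= 1 by rewrite ge_min lexx.
have dMc : d * M * n%:R <= c.
  apply: (@le_trans _ _ (c / (M * n%:R + 1) * (M * n%:R))).
    by rewrite -mulrA ler_wpM2r ?mulr_ge0 // ge_min lexx orbT.
  rewrite -mulrA ler_piMr ?(ltW c0) // mulrC ler_pdivrMr // mul1r; lra.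
exists (fun i => d ^+ i ^+ 2), (d ^+ n ^+ 2), c; split => //.
- by rewrite !exprn_gt0.
- move=> i; rewrite lerXn2r ?nnegrE ?exprn_ge0 ?(ltW d0) //.
  by rewrite ler_wiXn2l ?(ltW d0) // ltnW.
move=> y; rewrite Re_sum.
pose N i := normc (y i ord0).
have N0 i : 0 <= N i by exact: normc_ge0.
have key (i : 'I_n) : complex.Re ((d ^+ i ^+ 2)%:C%C * ((y i ord0)^*%C * (T *m y) i ord0)) <=
    - (2 * c) * (d ^+ i ^+ 2 * N i ^+ 2)
    + \sum_(j < n | (j < i)%N) d ^+ i ^+ 2 * (M * (N i * N j)).
  rewrite ReZl -mulr_sumr mulrCA -mulrDr ler_wpM2l ?exprn_ge0 ?(ltW d0) //.
  rewrite mxE mulr_sumr Re_sum (bigID (fun j : 'I_n => (j < i)%N)) /= addrC lerD //.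
    rewrite (bigD1 i) ?ltnn //= big1 ?addr0; last first.
      move=> j /andP[]; rewrite -leqNgt leq_eqVlt => /orP[/eqP/val_inj->|ij _].
        by rewrite eqxx.
      by rewrite trT // mul0r mulr0.
    rewrite mulrCA mul_conjc_normc mulrC ReZl mulrC.
    by rewrite ler_wpM2r ?sqr_ge0 ?cT.
  apply: ler_sum => j _; apply: le_trans (Re_le_normc _) _.
  by rewrite !Normc.normcM normc_conj mulrCA ler_wpM2r ?mulr_ge0 ?TM ?normc_ge0.
apply: le_trans (ler_sum _ (fun i _ => key i)) _.
rewrite big_split /= -mulr_sumr.
have := weighted_trig_bound M0 (introT andP (conj d0 d1)) dMc N0.
by set A := \sum_i _; set B := \sum_i _ => AB; rewrite -/B; lra.
Qed.

Lemma innerE (K : comPzRingType) (n : nat) (u v : 'cV[K]_n) :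
  inner u v = (u^T *m v) ord0 ord0.
Proof. by rewrite mxE; apply: eq_bigr => i _; rewrite mxE. Qed.

Lemma complexifyE (R : realType) (m n : nat) (A : 'M[R]_(m, n)) :
  complexify A = map_mx (real_complex R) A.
Proof. by []. Qed.

Lemma complexifyM (R : realType) (m n p : nat) (A : 'M[R]_(m, n)) (B : 'M[R]_(n, p)) :
  complexify (A *m B) = complexify A *m complexify B.
Proof. by rewrite !complexifyE map_mxM. Qed.

(** This turns the complex form built from a Schur basis into a form with a real matrix. *)
Lemma Re_mx_form (R : realType) (n : nat) (H : 'M[R[i]]_n) (v z : 'cV[R]_n) :
  inner v (map_mx (@complex.Re R) H *m z) =
    complex.Re (((complexify v)^T *m H *m complexify z) ord0 ord0).
Proof.
rewrite -mulmxA mxE Re_sum; apply: eq_bigr => i _.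
rewrite !mxE ReZl; congr (_ * _); rewrite Re_sum; apply: eq_bigr => j _.
by rewrite !mxE mulrC [in RHS]mulrC ReZl.
Qed.

(** The hypothesis says that [x] is real, so that [x^T] and [U ^t*] combine into the conjugate
    transpose of [U *m x]. *)
Lemma unitary_diag_form (C : numClosedFieldType) (n : nat) (U : 'M[C]_n) (w : 'rV[C]_n)
    (x y : 'cV[C]_n) :
  x^T = (x ^t*)%sesqui ->
  (x^T *m ((U ^t*)%sesqui *m diag_mx w *m U) *m y) ord0 ord0 =
    \sum_i w ord0 i * (((U *m x) i ord0)^* * (U *m y) i ord0).
Proof.
move=> ->; rewrite !mulmxA -map_mxM -trmx_mul -!mulmxA mxE; apply: eq_bigr => i _.
by rewrite mul_diag_mx mxE mulrCA; congr (_ * (_ * _)); rewrite [LHS]mxE [in LHS]mxE.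
Qed.

(** Eigenvectors are rows here: if [v] is one for [T], then [v *m U] is one for [B] with the same
    eigenvalue. *)
Lemma spectrum_trig (R : realType) (n : nat) (B : 'M[R]_n) (U T : 'M[R[i]]_n) :
  spectrum_in_left_half_plane B -> U \in unitmx -> is_trig_mx T ->
  T *m U = U *m complexify B -> forall i, complex.Re (T i i) < 0.
Proof.
move=> hB Uu Ttr TU i; apply: hB.
have : eigenvalue T (T i i).
  rewrite eigenvalue_root_char char_poly_trig // rootE.
  by rewrite (bigD1 i) //= hornerM hornerXsubC subrr mul0r.
case/eigenvalueP => v vT v0; apply/eigenvalueP; exists (v *m U).
  by rewrite -mulmxA -TU mulmxA vT scalemxAl.
apply: contra v0 => /eqP vU; rewrite -(mulmxK Uu v) vU mul0mx //.
Qed.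

(** In the Schur coordinates [U v] the matrix [B] acts as the triangular [T], and [P] is the
    weighted norm of [trig_dissipative] pulled back to real vectors. *)
Lemma lyapunov_form (R : realType) (n : nat) (B : 'M[R]_n) :
  (0 < n)%N -> spectrum_in_left_half_plane B ->
  exists (P : 'M[R]_n) (a c : R),
    [/\ 0 < a, 0 < c, P^T = P,
        forall v : 'cV_n, a * inner v v <= inner v (P *m v) &
        forall v : 'cV_n, inner v (P *m (B *m v)) <= - c * inner v (P *m v)].
Proof.
move=> n0 hB; have [U Uu /= Ttr] := Schur (complexify B) n0.
have UU : (U ^t*)%sesqui *m U = 1%:M by apply: mulmx1C; exact/unitarymxP.
move: Ttr; rewrite /similar_to conjymx //; set T := U *m _ *m _ => Ttr.
have TU : T *m U = U *m complexify B by rewrite /T -mulmxA UU mulmx1.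
have [w [m [c [m0 c0 mw wT]]]] := trig_dissipative Ttr
  (spectrum_trig hB (unitarymx_unit Uu) Ttr TU).
pose D : 'rV[R[i]]_n := \row_i (w i)%:C%C.
pose H := (U ^t*)%sesqui *m diag_mx D *m U.
pose P := map_mx (@complex.Re R) H.
have cvT (v : 'cV[R]_n) : (complexify v)^T = ((complexify v) ^t*)%sesqui.
  by apply/matrixP => i j; rewrite !mxE; apply/esym/conjc_real.
have PE (v z : 'cV[R]_n) : inner v (P *m z) = complex.Re (\sum_i (w i)%:C%C *
    (((U *m complexify v) i ord0)^*%C * (U *m complexify z) i ord0)).
  rewrite Re_mx_form unitary_diag_form //; congr complex.Re.
  by apply: eq_bigr => i _; rewrite [in LHS]mxE.
have Pvv (v : 'cV[R]_n) : inner v (P *m v) =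
    \sum_i w i * normc ((U *m complexify v) i ord0) ^+ 2.
  rewrite PE Re_sum; apply: eq_bigr => i _.
  by rewrite mul_conjc_normc ReZl.
(* Unitarity of [U], read off from the same diagonal formula with all weights equal to 1. *)
have iso (v : 'cV[R]_n) : inner v v = \sum_i normc ((U *m complexify v) i ord0) ^+ 2.
  have -> : inner v v = inner v (map_mx (@complex.Re R) 1%:M *m v).
    congr inner; rewrite -[LHS]mul1mx; congr (_ *m _).
    by apply/matrixP => i j; rewrite !mxE; case: (i == j).
  rewrite Re_mx_form -UU -[X in X *m U]mulmx1 -diag_const_mx unitary_diag_form // Re_sum.
  by apply: eq_bigr => i _; rewrite mxE mul1r (mul_conjc_normc).
exists P, m, c; split => //.
(* The entrywise real part of a Hermitian matrix is symmetric. *)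
- apply/matrixP => i j; rewrite !mxE !Re_sum; apply: eq_bigr => k _.
  rewrite !mul_mx_diag !mxE -mulrA -[in RHS]mulrA mulrCA [in RHS]mulrCA !ReZl; congr (_ * _).
  by case: (U k i) => ? ?; case: (U k j) => ? ? /=; ring.
- move=> v; rewrite iso Pvv mulr_sumr; apply: ler_sum => i _.
  by rewrite ler_wpM2r ?sqr_ge0.
- move=> v; rewrite Pvv PE complexifyM mulmxA -TU -mulmxA; exact: wT.
Qed.

(** * The matrix exponential *)

Lemma cvg_mx_entries (R : realType) (m n : nat) (u : ('M[R]_(m, n))^nat) (M : 'M[R]_(m, n)) :
  (forall i j, (u k i j) @[k --> \oo] --> M i j) -> u @ \oo --> M.
Proof.
move=> uM A [B MB BA]; change (\forall k \near \oo, A (u k)).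
have : \forall k \near \oo, forall i j, B i j (u k i j); last first.
  by apply: filterS => k Bk; apply: BA.
by apply: filter_forall => i; apply: filter_forall => j; apply: uM; exact: MB.
Qed.

(** Each entry of [exp (t B)] becomes a scalar power series in [t], open to termwise
    differentiation. *)
Definition exp_entry_coef (R : realType) (n : nat) (B : 'M[R]_n) (i j : 'I_n) : R ^nat :=
  fun k => (B ^+ k) i j / k`!%:R.

Lemma cvg_sumr (R : realType) (I : Type) (r : seq I) (T : Type) (F : set_system T)
    (FF : Filter F) (f : I -> T -> R) (l : I -> R) :
  (forall i, f i x @[x --> F] --> l i) ->
  (\sum_(i <- r) f i x) @[x --> F] --> \sum_(i <- r) l i.
Proof. by move=> fl; apply: cvg_big => //; exact: add_continuous. Qed.

(** The sum [K] of all absolute entries dominates every row sum, which carries the induction on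
    [k]. *)
Lemma mx_entry_pow_bound (R : realType) (n : nat) (B : 'M[R]_n) :
  exists K : R, 0 <= K /\ forall k i j, `|(B ^+ k) i j| <= K ^+ k.
Proof.
pose K : R := \sum_i \sum_j `|B i j|.
have rowK i : \sum_j `|B i j| <= K.
  by rewrite /K [leRHS](bigD1 i) //= lerDl sumr_ge0 // => *; rewrite sumr_ge0.
have K0 : 0 <= K by rewrite sumr_ge0 // => *; rewrite sumr_ge0.
exists K; split=> // k; elim: k => [|k IH] i j.
  by rewrite !expr0 mxE; case: (i == j); rewrite ?normr1 ?normr0.
rewrite !exprS -mulmxE mxE; apply: le_trans (ler_norm_sum _ _ _) _.
apply: (@le_trans _ _ (\sum_l `|B i l| * K ^+ k)).
  by apply: ler_sum => l _; rewrite normrM ler_wpM2l.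
by rewrite -mulr_suml ler_wpM2r ?exprn_ge0.
Qed.

Lemma is_cvg_exp_entry (R : realType) (n : nat) (B : 'M[R]_n) (i j : 'I_n) (t : R) :
  cvgn (pseries (exp_entry_coef B i j) t).
Proof.
have [K [K0 BK]] := mx_entry_pow_bound B.
(* Comparison with the scalar exponential series at [K * |t|]. *)
apply: normed_cvg; apply: (@series_le_cvg _ _ (exp_coeff (K * `|t|))).
- by move=> k /=.
- by move=> k; rewrite exp_coeff_ge0 // mulr_ge0.
- move=> k /=; rewrite /exp_entry_coef /exp_coeff /= !normrM normrX exprMn normfV.
  rewrite [X in _ / X]ger0_norm // mulrAC ler_wpM2r ?invr_ge0 //.
  by rewrite ler_wpM2r ?exprn_ge0.
- exact: is_cvg_series_exp_coeff.
Qed.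

Lemma exp_mxE (R : realType) (n : nat) (B : 'M[R]_n) (t : R) (i j : 'I_n) :
  exp_mx (t *: B) i j = limn (pseries (exp_entry_coef B i j) t).
Proof.
pose M : 'M[R]_n := \matrix_(i, j) limn (pseries (exp_entry_coef B i j) t).
suff -> : exp_mx (t *: B) = M by rewrite mxE.
apply: cvg_lim; first exact: norm_hausdorff.
apply: cvg_mx_entries => a b; rewrite mxE.
rewrite (_ : (fun k => _) = pseries (exp_entry_coef B a b) t); first exact: is_cvg_exp_entry.
apply/funext => k; rewrite /pseries /series /= summxE; apply: eq_bigr => l _.
rewrite /exp_entry_coef.
have -> : (t *: B) ^+ l = t ^+ l *: B ^+ l.
  elim: l => [|l IH]; first by rewrite !expr0 scale1r.
  by rewrite !exprS IH -!mulmxE -scalemxAl -scalemxAr scalerA.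
by rewrite !mxE; ring.
Qed.

Lemma pseries_lincomb (R : realType) (n : nat) (a : 'I_n -> R) (f : 'I_n -> R ^nat) (t : R) :
  pseries (fun k => \sum_l a l * f l k) t = fun k => \sum_l a l * pseries (f l) t k.
Proof.
apply/funext => k; rewrite /pseries /series /=.
under [RHS]eq_bigr do rewrite mulr_sumr.
rewrite exchange_big /=; apply: eq_bigr => m _; rewrite mulr_suml.
by apply: eq_bigr => l _; rewrite mulrA.
Qed.

Lemma pseries_diffs_lincomb (R : realType) (n : nat) (a : 'I_n -> R) (f : 'I_n -> R ^nat) :
  pseries_diffs (fun k => \sum_l a l * f l k) =
    fun k => \sum_l a l * pseries_diffs (f l) k.
Proof.
apply/funext => k; rewrite /pseries_diffs mulr_sumr.
by apply: eq_bigr => l _; rewrite mulrCA.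
Qed.

(** The factor [k + 1] from differentiation cancels against the factorial, and
    [B ^+ k.+1 = B * B ^+ k]. *)
Lemma pseries_diffs_exp_entry (R : realType) (n : nat) (B : 'M[R]_n) (i j : 'I_n) :
  pseries_diffs (exp_entry_coef B i j) =
    fun k => \sum_l B i l * exp_entry_coef B l j k.
Proof.
apply/funext => k.
rewrite /pseries_diffs /exp_entry_coef exprS -mulmxE mxE factS natrM mulr_suml mulr_sumr.
apply: eq_bigr => l _; rewrite invfM.
by field; rewrite ?nat1r ?pnatr_eq0 -?lt0n ?fact_gt0.
Qed.

Lemma is_derive_exp_mx (R : realType) (n : nat) (B : 'M[R]_n) (i j : 'I_n) (t : R) :
  is_derive t (1 : R) (fun s : R => exp_mx (s *: B) i j) ((B *m exp_mx (t *: B)) i j).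
Proof.
have cvl a (f : 'I_n -> R ^nat) s : (forall l, cvgn (pseries (f l) s)) ->
    pseries (fun k => \sum_l B a l * f l k) s @ \oo -->
      \sum_l B a l * limn (pseries (f l) s).
  by move=> cf; rewrite pseries_lincomb; apply: cvg_sumr => l; apply: cvgMl_tmp; exact: cf.
have cv a b s : cvgn (pseries (pseries_diffs (exp_entry_coef B a b)) s).
  rewrite pseries_diffs_exp_entry; apply: cvgP; apply: cvl => l; exact: is_cvg_exp_entry.
have -> : (fun s : R => exp_mx (s *: B) i j) = (fun s => limn (pseries (exp_entry_coef B i j) s)).
  by apply/funext => s; rewrite exp_mxE.
have -> : (B *m exp_mx (t *: B)) i j = limn (pseries (pseries_diffs (exp_entry_coef B i j)) t).
  rewrite pseries_diffs_exp_entry mxE; apply/esym/cvg_lim; first exact: norm_hausdorff.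
  under eq_bigr do rewrite exp_mxE.
  by apply: cvl => l; exact: is_cvg_exp_entry.
(* Termwise differentiation at [t] asks for convergence of the series and its first two formal
   derivatives at a point of larger modulus. *)
apply: (@pseries_snd_diffs _ _ (`|t| + 1)); [exact: is_cvg_exp_entry|exact: cv| |].
  rewrite pseries_diffs_exp_entry pseries_diffs_lincomb.
  by apply: cvgP; apply: cvl => l; exact: cv.
by rewrite [ltRHS]ger0_norm ?addr_ge0 // ltrDl.
Qed.

Lemma exp_mx0 (R : realType) (n : nat) (B : 'M[R]_n) : exp_mx (0 *: B) = 1%:M.
Proof.
apply/matrixP => i j; rewrite exp_mxE; apply: cvg_lim; first exact: norm_hausdorff.
(* The partial sum of index 0 is empty; from index 1 on, only the constant term survives. *)
apply: cvg_near_cst; exists 1%N => // -[//|k] _.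
rewrite /pseries /series /= big_mkord big_ord_recl big1 ?addr0; last first.
  by move=> l _; rewrite /= expr0n mulr0.
by rewrite /exp_entry_coef !expr0 mulr1 fact0 divr1.
Qed.

Lemma trmxX (K : comPzRingType) (n : nat) (A : 'M[K]_n) (k : nat) : (A ^+ k)^T = (A^T) ^+ k.
Proof.
elim: k => [|k IH]; first by rewrite !expr0; exact: trmx1.
by rewrite exprS exprSr -!mulmxE trmx_mul IH.
Qed.

Lemma exp_mx_tr (R : realType) (n : nat) (B : 'M[R]_n) (t : R) :
  exp_mx (t *: B^T) = (exp_mx (t *: B))^T.
Proof.
apply/matrixP => i j; rewrite [in RHS]mxE !exp_mxE; congr (limn (pseries _ _)).
by apply/funext => k; rewrite /exp_entry_coef -trmxX mxE.
Qed.

Lemma innerC (K : comPzRingType) (n : nat) (u v : 'cV[K]_n) : inner u v = inner v u.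
Proof. by apply: eq_bigr => i _; rewrite mulrC. Qed.

Lemma inner_adj (K : comPzRingType) (m n : nat) (A : 'M[K]_(m, n)) (u : 'cV[K]_n)
    (v : 'cV[K]_m) : inner (A *m u) v = inner u (A^T *m v).
Proof. by rewrite !innerE trmx_mul mulmxA. Qed.

(** Entrywise, so that scalar rules apply to products of matrices of different sizes. *)
Definition mx_is_derive (R : realType) (m n : nat) (A : R -> 'M[R]_(m, n)) (t : R)
    (dA : 'M[R]_(m, n)) : Prop :=
  forall i j, is_derive t (1 : R) (fun s => A s i j) (dA i j).

Lemma mx_is_derive_cst (R : realType) (m n : nat) (A : 'M[R]_(m, n)) (t : R) :
  mx_is_derive (fun=> A) t 0.
Proof. by move=> i j; rewrite mxE; exact: is_derive_cst. Qed.

Lemma mx_is_deriveM (R : realType) (m n p : nat) (A : R -> 'M[R]_(m, n))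
    (C : R -> 'M[R]_(n, p)) (t : R) (dA : 'M[R]_(m, n)) (dC : 'M[R]_(n, p)) :
  mx_is_derive A t dA -> mx_is_derive C t dC ->
  mx_is_derive (fun s => A s *m C s) t (dA *m C t + A t *m dC).
Proof.
move=> hA hC i j.
have -> : (fun s => (A s *m C s) i j) = \sum_l ((fun s => A s i l) * (fun s => C s l j)).
  by apply/funext => s; rewrite mxE fct_sumE.
apply: is_derive_eq.
  by apply: is_derive_sum => l; apply: is_deriveM; [exact: hA|exact: hC].
rewrite !mxE -big_split /=; apply: eq_bigr => l _.
by rewrite addrC; congr (_ + _); exact: mulrC.
Qed.

Lemma mx_is_derive_tr (R : realType) (m n : nat) (A : R -> 'M[R]_(m, n)) (t : R)
    (dA : 'M[R]_(m, n)) :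
  mx_is_derive A t dA -> mx_is_derive (fun s => (A s)^T) t dA^T.
Proof.
move=> hA i j; rewrite mxE.
by rewrite (_ : (fun s => _) = (fun s => A s j i)) //; apply/funext => s; rewrite mxE.
Qed.

Lemma mx_is_derive_expl (R : realType) (n : nat) (B : 'M[R]_n) (t : R) :
  mx_is_derive (fun s => exp_mx (s *: B)) t (B *m exp_mx (t *: B)).
Proof. by move=> i j; exact: is_derive_exp_mx. Qed.

(** Transposing the left-hand version for [B^T] puts [B] on the right without a commutation
    argument. *)
Lemma mx_is_derive_expr (R : realType) (n : nat) (B : 'M[R]_n) (t : R) :
  mx_is_derive (fun s => exp_mx (s *: B)) t (exp_mx (t *: B) *m B).
Proof.
have := mx_is_derive_tr (mx_is_derive_expl B^T t).
rewrite trmx_mul trmxK exp_mx_tr trmxK; congr mx_is_derive.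
by apply/funext => s; rewrite exp_mx_tr trmxK.
Qed.

Lemma mx_is_derive_congr_exp (R : realType) (n : nat) (B X : 'M[R]_n) (t : R) :
  mx_is_derive (fun s => exp_mx (s *: B) *m X *m (exp_mx (s *: B))^T) t
    (exp_mx (t *: B) *m (B *m X + X *m B^T) *m (exp_mx (t *: B))^T).
Proof.
have hE := mx_is_derive_expr B t.
have := mx_is_deriveM (mx_is_deriveM hE (mx_is_derive_cst X t)) (mx_is_derive_tr hE).
by rewrite mulmx0 addr0 trmx_mul mulmxDr mulmxDl !mulmxA.
Qed.

(** The Lyapunov form decays like [exp (- 2 c s)] along the column [u], a solution of [u' = B u],
    and it controls the square of each entry. *)
Lemma exp_mx_cvg0 (R : realType) (n : nat) (B : 'M[R]_n) (i j : 'I_n) :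
  spectrum_in_left_half_plane B ->
  exp_mx (s *: B) i j @[s --> +oo] --> (0 : R).
Proof.
move=> hB; have n0 : (0 < n)%N by apply: leq_ltn_trans (ltn_ord i).
have [P [a [c [a0 c0 Psym Pa Pc]]]] := lyapunov_form n0 hB.
pose u s : 'cV[R]_n := exp_mx (s *: B) *m delta_mx j ord0.
pose phi s := inner (u s) (P *m u s).
have uE s : u s i ord0 = exp_mx (s *: B) i j by rewrite /u -colE mxE.
have du t : mx_is_derive u t (B *m u t).
  have := mx_is_deriveM (mx_is_derive_expl B t) (mx_is_derive_cst (delta_mx j (ord0 : 'I_1)) t).
  by rewrite mulmx0 addr0 -mulmxA.
have dphi t : is_derive t (1 : R) phi (2 * inner (u t) (P *m (B *m u t))).
  have h := mx_is_deriveM (mx_is_derive_tr (du t)) (mx_is_deriveM (mx_is_derive_cst P t) (du t)).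
  have := h ord0 ord0; rewrite (_ : (fun s => _) = phi); last first.
    by apply/funext => s; rewrite /phi innerE.
  move=> h'; apply: (is_derive_eq h').
  rewrite mul0mx add0r mxE -!innerE.
  have -> : inner (B *m u t) (P *m u t) = inner (u t) (P *m (B *m u t)).
    by rewrite innerC inner_adj Psym.
  by rewrite mulr_natl.
have dexp t : is_derive t (1 : R) (fun s => expR (2 * c * s)) (2 * c * expR (2 * c * t)).
  have dlin : is_derive t (1 : R) (fun s : R => 2 * c * s) (2 * c).
    apply: (is_derive_eq (is_deriveM (is_derive_cst (2 * c) t (1 : R)) (is_derive_id t (1 : R)))).
    by rewrite /GRing.scale /= mulr1 mulr0 addr0.
  apply: (is_derive_eq (is_derive1_comp (is_derive_expR (2 * c * t)) dlin)).
  exact: mulrC.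
pose psi s := phi s * expR (2 * c * s).
have dpsi t : is_derive t (1 : R) psi
    ((2 * inner (u t) (P *m (B *m u t)) + 2 * c * phi t) * expR (2 * c * t)).
  apply: (is_derive_eq (is_deriveM (dphi t) (dexp t))).
  rewrite /GRing.scale /=; ring.
have psi_le s : 0 <= s -> psi s <= psi 0.
  move=> s0; apply: (@ler0_derive1_nincry _ psi 0) => //.
  - move=> x _; rewrite derive1E (@derive_val _ _ _ _ _ _ _ (dpsi x)).
    rewrite mulr_le0_ge0 ?expR_ge0 //; have := Pc (u x); rewrite -/(phi x).
    set y := inner _ _ => h; lra.
  - by apply: derivable_within_continuous => x _; exact: (@ex_derive _ _ _ _ _ _ _ (dpsi x)).
have sq s : a * exp_mx (s *: B) i j ^+ 2 <= phi s.
  apply: le_trans (Pa (u s)); rewrite ler_wpM2l ?(ltW a0) // /inner (bigD1 i) //=.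
  by rewrite uE -expr2 lerDl sumr_ge0 // => k _; rewrite -expr2 sqr_ge0.
apply/cvgr0Pnorm_lt => e e0.
near=> s.
have s0 : 0 < s by near: s; exact: nbhs_pinfty_gt.
(* Beyond this threshold an entry of size at least [e] would give [psi s >= a e^2 (2 c s) > psi 0],
   as [expR x >= x]. *)
have sK : psi 0 / (2 * c * a * e ^+ 2) < s by near: s; apply: nbhs_pinfty_gt; exact: num_real.
have pos : 0 < 2 * c * a * e ^+ 2 by rewrite !mulr_gt0.
rewrite ltr_pdivrMr // in sK.
rewrite ltNge; apply/negP => le.
have e2 : e ^+ 2 <= exp_mx (s *: B) i j ^+ 2.
  by rewrite -[leRHS]real_normK ?num_real // lerXn2r ?nnegrE ?(ltW e0).
have h1 : a * e ^+ 2 <= phi s by apply: le_trans (sq s); rewrite ler_wpM2l ?(ltW a0).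
have h2 : 2 * c * s <= expR (2 * c * s).
  by apply: le_trans (expR_ge1Dx _); rewrite lerDr.
have h3 : a * e ^+ 2 * (2 * c * s) <= psi s.
  by apply: ler_pM => //; rewrite ltW // !mulr_gt0 // exprn_gt0.
have := psi_le s (ltW s0); lra.
Unshelve. all: by end_near. Qed.

(** * The Lyapunov equation *)

Lemma inner0l (K : comPzRingType) (n : nat) (u : 'cV[K]_n) : inner 0 u = 0.
Proof. by rewrite /inner big1 // => i _; rewrite mxE mul0r. Qed.

Lemma innerDl (K : comPzRingType) (n : nat) (u v w : 'cV[K]_n) :
  inner (u + v) w = inner u w + inner v w.
Proof. by rewrite /inner -big_split; apply: eq_bigr => i _; rewrite mxE mulrDl. Qed.

Lemma innerNl (K : comPzRingType) (n : nat) (u w : 'cV[K]_n) : inner (- u) w = - inner u w.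
Proof. by rewrite /inner -sumrN; apply: eq_bigr => i _; rewrite mxE mulNr. Qed.

Lemma cvg_to_eq (R : realType) (F : set_system R) (a b : R) : F --> a -> a = b -> F --> b.
Proof. by move=> Fa <-. Qed.

Lemma congr_exp_mx_cvg0 (R : realType) (n : nat) (B X : 'M[R]_n) (i j : 'I_n) :
  spectrum_in_left_half_plane B ->
  (exp_mx (s *: B) *m X *m (exp_mx (s *: B))^T) i j @[s --> +oo] --> (0 : R).
Proof.
move=> hB.
rewrite (_ : (fun s => _) = fun s => \sum_l
    (\sum_k exp_mx (s *: B) i k * X k l) * exp_mx (s *: B) j l); last first.
  apply/funext => s; rewrite mxE; apply: eq_bigr => l _.
  by rewrite mxE [in X in _ * X]mxE.
apply: (@cvg_to_eq _ _ (\sum_(l < n) (\sum_(k < n) 0 * X k l) * 0)); last first.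
  by rewrite big1 // => l _; rewrite mulr0.
apply: cvg_sumr => l; apply: cvgM; last exact: exp_mx_cvg0.
by apply: cvg_sumr => k; apply: cvgMr_tmp; exact: exp_mx_cvg0.
Qed.

Lemma sylvester_inj (R : realType) (n : nat) (B X : 'M[R]_n) :
  spectrum_in_left_half_plane B -> B *m X + X *m B^T = 0 -> X = 0.
Proof.
move=> hB hX; apply/matrixP => i j; rewrite mxE.
pose G s := (exp_mx (s *: B) *m X *m (exp_mx (s *: B))^T) i j.
have dG (t : R) : is_derive t (1 : R) G 0.
  have := mx_is_derive_congr_exp B X t i j.
  by rewrite hX mulmx0 mul0mx mxE.
have G0 : G 0 = X i j by rewrite /G exp_mx0 trmx1 mulmx1 mul1mx.
have Gc : G = cst (X i j) by apply/funext => s; rewrite -G0; apply: is_derive_0_is_cst.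
have := @congr_exp_mx_cvg0 _ _ B X i j hB; rewrite -/G Gc => h.
apply: (cvg_unique (@norm_hausdorff _ R^o) _ h); exact: cvg_cst.
Qed.

(** On vectorized matrices the map is a square matrix [A], so a trivial kernel makes it
    invertible. *)
Lemma sylvester_surj (R : realType) (n : nat) (B Q : 'M[R]_n) :
  spectrum_in_left_half_plane B -> exists X : 'M[R]_n, B *m X + X *m B^T = Q.
Proof.
move=> hB; pose A := lin_mulmx B + lin_mulmxr B^T.
have AE (X : 'M[R]_n) : mxvec X *m A = mxvec (B *m X + X *m B^T).
  by rewrite mulmxDr !mul_vec_lin /= -linearD.
have fA : row_free A.
  rewrite -kermx_eq0; apply/eqP/row_matrixP => k; rewrite row0.
  have : row k (kermx A) *m A = 0 by rewrite -row_mul mulmx_ker row0.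
  rewrite -[row k _]vec_mxK AE => /(canRL mxvecK); rewrite linear0.
  by move=> /(sylvester_inj hB) ->; rewrite linear0.
exists (vec_mx (mxvec Q *m invmx A)); apply: (can_inj mxvecK).
by rewrite -AE vec_mxK mulmxKV // -row_free_unit.
Qed.

(** For quadratic forms the integrand is nonnegative, so the improper fundamental theorem of
    calculus yields both integrability and the value. *)
Lemma Q_infty_form (R : realType) (n : nat) (Q B X : 'M[R]_n) (v : 'cV[R]_n) :
  sym_psd Q -> spectrum_in_left_half_plane B -> B *m X + X *m B^T = - Q ->
  let f := fun s : R => inner v (exp_mx (s *: B) *m Q *m (exp_mx (s *: B))^T *m v) in
  lebesgue_measure.-integrable `[0, +oo[ (EFin \o f) /\
  \int[@lebesgue_measure R]_(s in `[0, +oo[) f s = inner v (X *m v).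
Proof.
move=> [Qs Qp] hB hX f.
(* A primitive of [f] by the equation for [X]; it vanishes at infinity. *)
pose F := fun s : R => - inner v (exp_mx (s *: B) *m X *m (exp_mx (s *: B))^T *m v).
have formE (Y : 'M[R]_n) (s : R) : inner v (exp_mx (s *: B) *m Y *m (exp_mx (s *: B))^T *m v) =
    (v^T *m ((exp_mx (s *: B) *m Y *m (exp_mx (s *: B))^T) *m v)) ord0 ord0.
  by rewrite innerE.
have dform (Y : 'M[R]_n) (t : R) : is_derive t (1 : R)
   (fun s => inner v (exp_mx (s *: B) *m Y *m (exp_mx (s *: B))^T *m v))
   (inner v (exp_mx (t *: B) *m (B *m Y + Y *m B^T) *m (exp_mx (t *: B))^T *m v)).
  have := mx_is_deriveM (mx_is_derive_cst v^T t)
    (mx_is_deriveM (mx_is_derive_congr_exp B Y t) (mx_is_derive_cst v t)).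
  move=> /(_ ord0 ord0); rewrite mulmx0 addr0 mul0mx add0r -innerE.
  by rewrite (_ : (fun s => _) = fun s => inner v (exp_mx (s *: B) *m Y *m (exp_mx (s *: B))^T *m v)) //;
    apply/funext => s; rewrite innerE.
have dF (t : R) : is_derive t (1 : R) F (f t).
  have h := is_deriveN (dform X t).
  apply: (is_derive_eq h); rewrite hX /f mulmxN !mulNmx.
  by rewrite /inner -sumrN; apply: eq_bigr => i _; rewrite mxE mulrN opprK.
have f0 (s : R) : 0 <= f s.
  rewrite /f -!mulmxA -[exp_mx _]trmxK -inner_adj trmxK; exact: Qp.
have Finf : F s @[s --> +oo] --> 0.
  rewrite -oppr0; apply: cvgN.
  rewrite (_ : (fun s => _) = fun s => \sum_i v i ord0 *
    \sum_j (exp_mx (s *: B) *m X *m (exp_mx (s *: B))^T) i j * v j ord0); last first.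
    by apply/funext => s; apply: eq_bigr => i _; rewrite mxE.
  apply: (@cvg_to_eq _ _ (\sum_(i < n) v i ord0 * \sum_(j < n) 0 * v j ord0)); last first.
    by rewrite big1 // => i _; rewrite big1 ?mulr0 // => j _; rewrite mul0r.
  apply: cvg_sumr => i; apply: cvgMl_tmp; apply: cvg_sumr => j; apply: cvgMr_tmp.
  exact: congr_exp_mx_cvg0.
have F0 : F 0 = - inner v (X *m v) by rewrite /F exp_mx0 trmx1 mulmx1 mul1mx.
have cf (t : R) : {for t, continuous f}.
  apply: differentiable_continuous; apply/derivable1_diffP.
  exact: (@ex_derive _ _ _ _ _ _ _ (dform Q t)).
have cF (t : R) : {for t, continuous F}.
  apply: differentiable_continuous; apply/derivable1_diffP.
  exact: (@ex_derive _ _ _ _ _ _ _ (dF t)).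
have int : (\int[lebesgue_measure]_(x in `[0%R, +oo[) (f x)%:E = (inner v (X *m v))%:E)%E.
  rewrite (ge0_continuous_FTC2y (F := F) (l := 0)) //.
  - by rewrite F0 -EFinB opprK add0r.
  - by apply: continuous_subspaceT => x; exact: cf.
  - by apply: cvg_at_right_filter; exact: cF.
  - by move=> x _; rewrite derive1E (@derive_val _ _ _ _ _ _ _ (dF x)).
split; last by rewrite /Rintegral int.
apply/integrableP; split.
  apply/measurable_EFinP; apply: measurable_funTS; apply: continuous_measurable_fun => x.
  exact: cf.
under eq_integral do rewrite /= ger0_norm //.
by rewrite int ltry.
Qed.

Lemma Q_inftyE (R : realType) (n : nat) (Q B X : 'M[R]_n) :
  sym_psd Q -> spectrum_in_left_half_plane B -> B *m X + X *m B^T = - Q ->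
  X^T = X /\ Q_infty Q B = X.
Proof.
move=> hQ hB hX; have [Qs _] := hQ.
(* The transpose solves the same equation because [Q] is symmetric, and solutions are unique. *)
have Xs : X^T = X.
  apply/eqP; rewrite -subr_eq0; apply/eqP; apply: (sylvester_inj hB).
  have := congr1 trmx hX; rewrite linearD /= !trmx_mul trmxK linearN /= Qs addrC => h.
  by rewrite mulmxBr mulmxBl addrACA -opprD hX opprK h addNr.
split => //; apply/matrixP => i j; rewrite mxE.
pose e (k : 'I_n) : 'cV[R]_n := delta_mx k ord0.
have eE (Y : 'M[R]_n) a b : inner (e a) (Y *m e b) = Y a b.
  by rewrite innerE mulmxA trmx_delta -rowE -colE !mxE.
(* Polarization reduces each entry to quadratic forms, whose integrands are nonnegative. *)
have bil (Y : 'M[R]_n) (u v : 'cV[R]_n) : inner (u + v) (Y *m (u + v)) =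
    inner u (Y *m u) + inner u (Y *m v) + (inner v (Y *m u) + inner v (Y *m v)).
  by rewrite mulmxDr innerDl !(innerC _ (_ + _)) !innerDl !(innerC (_ *m _)).
have Nr (Y : 'M[R]_n) (u v : 'cV[R]_n) : inner u (Y *m (- v)) = - inner u (Y *m v).
  by rewrite mulmxN innerC innerNl innerC.
have polE (Y : 'M[R]_n) : Y^T = Y -> Y i j = 4^-1 *
    (inner (e i + e j) (Y *m (e i + e j)) - inner (e i - e j) (Y *m (e i - e j))).
  move=> Ys; rewrite !bil !Nr !innerNl !eE.
  have -> : Y j i = Y i j by rewrite -[in RHS]Ys mxE.
  by field.
have [i1 e1] := Q_infty_form (e i + e j) hQ hB hX.
have [i2 e2] := Q_infty_form (e i - e j) hQ hB hX.
rewrite [RHS]polE // -e1 -e2 -RintegralB // -RintegralZl //; last first.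
  have h := fun m => integrableB m i1 i2; exact: h.
apply: eq_Rintegral => s _; rewrite exp_mx_tr polE //.
by rewrite !trmx_mul trmxK Qs mulmxA.
Qed.

(** * The Kalman condition as observability *)

Lemma inner_eq0 (R : realType) (n : nat) (w : 'cV[R]_n) : inner w w = 0 -> w = 0.
Proof.
move=> /eqP; rewrite psumr_eq0 => [/allP h|i _]; last by rewrite -expr2 sqr_ge0.
apply/matrixP => i j; rewrite ord1 mxE.
by have := h i (mem_index_enum _); rewrite mulf_eq0 orbb => /eqP.
Qed.

(* The spectral theorem is not needed here: without a square root, [sqrt_mx Q] would be
   the default [0], and the Kalman matrix would have rank [0 < n]. *)
Lemma sqrt_mxP (R : realType) (n : nat) (Q B : 'M[R]_n) :
  (0 < n)%N -> kalman_rank Q B -> sym_psd (sqrt_mx Q) /\ sqrt_mx Q *m sqrt_mx Q = Q.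
Proof.
move=> n0 hK; have [[S hS]|noS] := pselect (exists S, sym_psd S /\ S *m S = Q).
  exact: (@xgetPex _ 0 [set S : 'M[R]_n | sym_psd S /\ S *m S = Q] (ex_intro _ S hS)).
exfalso; have S0 : sqrt_mx Q = 0 by apply: xgetPN => S hS; apply: noS; exists S.
suff h : \rank (\mxrow_(j < n) (B ^+ j *m sqrt_mx Q)) = 0%N.
  by move: hK n0; rewrite /kalman_rank h => <-.
rewrite (_ : \mxrow_(j < n) _ = 0) ?mxrank0 //.
by under eq_mxrow do rewrite S0 mulmx0; apply/matrixP => i j; rewrite !mxE.
Qed.

(** [Q] and its square root have the same kernel, so [v^T] annihilates the Kalman matrix, which has
    full row rank. *)
Lemma kalman_observable (R : realType) (n : nat) (Q B : 'M[R]_n) (v : 'cV[R]_n) :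
  (0 < n)%N -> kalman_rank Q B ->
  (forall j, (j < n)%N -> Q *m ((B^T) ^+ j *m v) = 0) -> v = 0.
Proof.
move=> n0 hK hv; have [[Ss _] SS] := sqrt_mxP n0 hK.
have Sv (j : 'I_n) : sqrt_mx Q *m ((B^T) ^+ j *m v) = 0.
  apply: inner_eq0; rewrite inner_adj Ss (mulmxA (sqrt_mx Q) (sqrt_mx Q)) SS hv //.
  by rewrite innerC inner0l.
have : v^T *m (\mxrow_(j < n) (B ^+ j *m sqrt_mx Q)) = 0.
  rewrite mul_mxrow (_ : \mxrow_(j < n) _ = \mxrow_(j < n) (0 : 'M[R]_(1, n))).
    by apply/matrixP => i j; rewrite !mxE.
  apply: eq_mxrow => j; apply: trmx_inj; rewrite trmx0 -(Sv j).
  by rewrite !trmx_mul trmxK trmxX Ss mulmxA.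
move/eqP; rewrite mulmx_free_eq0 ?trmx_eq0 => [/eqP //|].
by rewrite /row_free hK.
Qed.

Lemma unitmx_ker (K : fieldType) (n : nat) (A : 'M[K]_n) :
  (forall v : 'cV_n, A *m v = 0 -> v = 0) -> A \in unitmx.
Proof.
move=> hA; rewrite -unitmx_tr -row_free_unit -kermx_eq0; apply/eqP/row_matrixP => k.
rewrite row0; apply: trmx_inj; rewrite trmx0; apply: hA.
by apply: trmx_inj; rewrite trmx_mul trmxK -row_mul mulmx_ker row0 trmx0.
Qed.

Lemma lyapunov_solution_unit (R : realType) (n : nat) (Q B X : 'M[R]_n) :
  (0 < n)%N -> kalman_rank Q B -> X^T = X -> B *m X + X *m B^T = - Q -> X \in unitmx.
Proof.
move=> n0 hK Xs hX; apply: unitmx_ker => v Xv; apply: (kalman_observable n0 hK) => j _.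
have [[Ss _] SS] := sqrt_mxP n0 hK.
(* On the kernel of [X] the equation reads [X B^T w = - Q w]; pairing with [w] gives [<w, Q w> = 0],
   hence [Q w = 0]. *)
have step (w : 'cV[R]_n) : X *m w = 0 -> Q *m w = 0 /\ X *m (B^T *m w) = 0.
  move=> Xw; have e : X *m (B^T *m w) = - (Q *m w).
    by rewrite -mulNmx -hX mulmxDl -!mulmxA Xw mulmx0 add0r.
  suff Qw : Q *m w = 0 by split => //; rewrite e Qw oppr0.
  rewrite -SS -mulmxA (_ : sqrt_mx Q *m w = 0) ?mulmx0 //; apply: inner_eq0.
  rewrite inner_adj Ss (mulmxA (sqrt_mx Q) (sqrt_mx Q)) SS -[Q *m w]opprK -e innerC innerNl innerC.
  by rewrite -[X in X *m _]Xs -inner_adj Xw inner0l oppr0.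
suff /step[] : X *m ((B^T) ^+ j *m v) = 0 by [].
elim: j => [|j IH]; first by rewrite expr0 mul1mx.
by have [_ h] := step _ IH; rewrite exprS -mulmxE -(mulmxA B^T).
Qed.

(* Output injection: feeding the output [Q v] back into the dynamics does not change
   the unobservable subspace. *)
Lemma output_injection (K : fieldType) (n : nat) (Q C L : 'M[K]_n) (a : K) (v : 'cV[K]_n) (N : nat) :
  a != 0 -> (forall j, (j < N)%N -> Q *m ((a *: (C + L *m Q)) ^+ j *m v) = 0) ->
  forall j, (j < N)%N -> Q *m (C ^+ j *m v) = 0.
Proof.
move=> a0 h.
(* Power [j] uses only outputs of index below [j], all zero, so [L *m Q] never contributes; hence
   [j = N] is allowed. *)
have e j : (j <= N)%N -> (a *: (C + L *m Q)) ^+ j *m v = a ^+ j *: (C ^+ j *m v).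
  elim: j => [_|j IH jN]; first by rewrite !expr0 scale1r.
  have Qj : Q *m (C ^+ j *m v) = 0.
    apply: (scalerI (expf_neq0 j a0)); rewrite scaler0 scalemxAr -IH ?(ltnW jN) //.
    exact: h.
  rewrite exprS -mulmxE -mulmxA IH ?(ltnW jN) // -scalemxAl -scalemxAr scalerA -exprS.
  by rewrite mulmxDl -!mulmxA Qj mulmx0 addr0 mulmxA mulmxE -exprS.
move=> j jN; apply: (scalerI (expf_neq0 j a0)).
by rewrite scaler0 scalemxAr -e ?(ltnW jN) // h.
Qed.

(** * The Hamilton map *)

Definition mx_of_parts (R : realType) (m n : nat) (A C : 'M[R]_(m, n)) : 'M[R[i]]_(m, n) :=
  complexify A + 'i%C *: complexify C.

Lemma Re_mx_of_parts (R : realType) (n : nat) (A C : 'M[R]_n) :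
  Re_mx (mx_of_parts A C) = complexify A.
Proof.
apply/matrixP => i j; rewrite !mxE -complexRe; congr (_%:C%C).
by rewrite /= !mul0r mul1r subr0 addr0.
Qed.

Lemma Im_mx_of_parts (R : realType) (n : nat) (A C : 'M[R]_n) :
  Im_mx (mx_of_parts A C) = complexify C.
Proof.
apply/matrixP => i j; rewrite !mxE -complexIm; congr (_%:C%C).
by rewrite /= !mul0r mul1r !add0r.
Qed.

Lemma complexifyX (R : realType) (n : nat) (A : 'M[R]_n) (k : nat) :
  complexify (A ^+ k) = complexify A ^+ k.
Proof.
elim: k => [|k IH]; last by rewrite !exprS -!mulmxE complexifyM IH.
by rewrite !expr0; exact: map_mx1.
Qed.

Lemma innerZr (K : comPzRingType) (n : nat) (a : K) (u v : 'cV[K]_n) :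
  inner u (a *: v) = a * inner u v.
Proof. by rewrite /inner mulr_sumr; apply: eq_bigr => i _; rewrite mxE mulrCA. Qed.

Lemma symplecticDr (K : comPzRingType) (n : nat) (X Y Z : 'cV[K]_(n + n)) :
  symplectic X (Y + Z) = symplectic X Y + symplectic X Z.
Proof.
rewrite /symplectic !linearD /= !(innerC _ (_ + _)) !innerDl !(innerC _ (usubmx X)).
by rewrite !(innerC _ (dsubmx X)) opprD addrACA.
Qed.

Lemma symplecticZr (K : comPzRingType) (n : nat) (a : K) (X Y : 'cV[K]_(n + n)) :
  symplectic X (a *: Y) = a * symplectic X Y.
Proof.
by rewrite /symplectic !linearZ /= mulrBr !innerZr.
Qed.

Lemma symplectic_complexify (R : realType) (n : nat) (X Y : 'cV[R]_(n + n)) :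
  symplectic (complexify X) (complexify Y) = (symplectic X Y)%:C%C.
Proof.
rewrite /symplectic rmorphB /inner !rmorph_sum /=.
by congr (_ - _); apply: eq_bigr => i _; rewrite !mxE rmorphM.
Qed.

Lemma inner_delta (K : comPzRingType) (n : nat) (i : 'I_n) (v : 'cV[K]_n) :
  inner (delta_mx i ord0) v = v i ord0.
Proof. by rewrite innerE trmx_delta -rowE mxE. Qed.

(** Pairing with real basis vectors already reads off every complex coordinate, up to sign. *)
Lemma symplectic_nondegenerate (R : realType) (n : nat) (Z1 Z2 : 'cV[R[i]]_(n + n)) :
  (forall X : 'cV[R]_(n + n),
     symplectic (complexify X) Z1 = symplectic (complexify X) Z2) -> Z1 = Z2.
Proof.
move=> h; have c0 : complexify (0 : 'cV[R]_n) = 0 by rewrite complexifyE map_mx0.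
have cd i : complexify (delta_mx i ord0 : 'cV[R]_n) = delta_mx i ord0.
  by rewrite complexifyE map_delta_mx.
rewrite -[Z1]vsubmxK -[Z2]vsubmxK; congr col_mx; apply/matrixP => i j; rewrite ord1.
  have := h (col_mx 0 (delta_mx i ord0)).
  rewrite /symplectic complexifyE map_col_mx -!complexifyE !col_mxKd !col_mxKu c0 cd.
  by rewrite !inner0l !subr0 !inner_delta.
have := h (col_mx (delta_mx i ord0) 0).
rewrite /symplectic complexifyE map_col_mx -!complexifyE !col_mxKd !col_mxKu c0 cd.
by rewrite !inner0l !sub0r !inner_delta => /oppr_inj.
Qed.

Lemma hamilton_map_unique (R : realType) (n : nat) (q : 'cV[R]_(n + n) -> R[i])
    (F : 'M[R[i]]_(n + n)) :
  (forall X Y : 'cV[R]_(n + n),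
     polar q X Y = symplectic (complexify X) (F *m complexify Y)) ->
  hamilton_map q = F.
Proof.
move=> hF; have := @xgetPex _ 0 [set F : 'M[R[i]]_(n + n) | forall X Y : 'cV[R]_(n + n),
    polar q X Y = symplectic (complexify X) (F *m complexify Y)] (ex_intro _ F hF).
rewrite -/(hamilton_map q) /= => hq; apply/matrixP => i j.
have : hamilton_map q *m complexify (delta_mx j (ord0 : 'I_1)) = F *m complexify (delta_mx j ord0).
  by apply: symplectic_nondegenerate => X; rewrite -hq hF.
rewrite complexifyE map_delta_mx -!colE => /matrixP/(_ i ord0).
by rewrite !mxE.
Qed.

Lemma inner_polarization (R : realType) (n : nat) (u v : 'cV[R]_n) :
  inner (u + v) (u + v) - inner (u - v) (u - v) = 4 * inner u v.
Proof.
rewrite !innerDl !innerNl !(innerC _ (_ + _)) !innerDl !innerNl.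
by rewrite (innerC v u); ring.
Qed.

(** [K^T *m Q *m K] is the matrix of the form [|Q^(1/2) K x|^2]. *)
Definition OU_Re (R : realType) (n : nat) (Q K : 'M[R]_n) : 'M[R]_(n + n) :=
  block_mx 0 (2^-1 *: Q) (- 8^-1 *: (K^T *m Q *m K)) 0.

Definition OU_Im (R : realType) (n : nat) (M : 'M[R]_n) : 'M[R]_(n + n) :=
  block_mx (- 2^-1 *: M) 0 0 (2^-1 *: M^T).

(** By uniqueness it suffices to check the defining identity, separately on the real and imaginary
    parts of the polarized form. *)
Lemma OU_hamilton_map (R : realType) (n : nat) (Q B : 'M[R]_n) :
  sym_psd (sqrt_mx Q) -> sqrt_mx Q *m sqrt_mx Q = Q ->
  let K := invmx (Q_infty Q B) in
  hamilton_map (OU_form Q B) =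
    mx_of_parts (OU_Re Q K) (OU_Im (2^-1 *: (Q *m K) + B)).
Proof.
move=> [Ss _] SS K; apply: hamilton_map_unique => X Y.
rewrite mulmxDl -scalemxAl -!complexifyM symplecticDr symplecticZr !symplectic_complexify.
set M := _ + B; set S := sqrt_mx Q in Ss SS *.
pose x := usubmx X; pose xi := dsubmx X; pose y := usubmx Y; pose eta := dsubmx Y.
have reE : symplectic X (OU_Re Q K *m Y) =
    2^-1 * inner (S *m xi) (S *m eta) + 8^-1 * inner (S *m K *m x) (S *m K *m y).
  rewrite -[Y]vsubmxK mul_block_col !mul0mx add0r addr0 /symplectic col_mxKu col_mxKd.
  rewrite -!scalemxAl !innerZr !inner_adj mulNr opprK.
  rewrite (_ : S^T *m (S *m eta) = Q *m eta); last by rewrite Ss mulmxA SS.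
  rewrite (_ : (S *m K)^T *m (S *m K *m y) = K^T *m Q *m K *m y) //.
  by rewrite trmx_mul Ss !mulmxA -(mulmxA K^T S S) SS.
have imE : symplectic X (OU_Im M *m Y) =
    - 2^-1 * (inner (M *m x) eta + inner (M *m y) xi).
  rewrite -[Y]vsubmxK mul_block_col !mul0mx add0r addr0 /symplectic col_mxKu col_mxKd.
  rewrite -!scalemxAl !innerZr -inner_adj (innerC _ (M *m y)) -/x -/y -/xi -/eta; ring.
have uD : usubmx (X + Y) = x + y by rewrite linearD.
have uB : usubmx (X - Y) = x - y by rewrite linearB.
have dD : dsubmx (X + Y) = xi + eta by rewrite linearD.
have dB : dsubmx (X - Y) = xi - eta by rewrite linearB.
rewrite reE imE /polar /OU_form -/K -/M -/S uD uB dD dB.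
rewrite !mulmxDr !mulmxN.
set a1 := S *m xi; set a2 := S *m eta; set b1 := S *m K *m x; set b2 := S *m K *m y.
have ra := inner_polarization a1 a2; have rb := inner_polarization b1 b2.
have rm : inner (M *m x + M *m y) (xi + eta) - inner (M *m x - M *m y) (xi - eta) =
    2 * (inner (M *m x) eta + inner (M *m y) xi).
  by rewrite !innerDl !innerNl !(innerC _ (_ + _)) !innerDl !innerNl
    !(innerC xi) !(innerC eta); ring.
move: ra rb rm; set p1 := inner (a1 + a2) _; set p2 := inner (a1 - a2) _.
set p3 := inner (b1 + b2) _; set p4 := inner (b1 - b2) _.
set p5 := inner (_ + _) _; set p6 := inner (_ - _) _ => ra rb rm.
(* With all mixed products written through the values [p1] to [p6] occurring in [polar], the
   identity becomes linear in them. *)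
have -> : inner a1 a2 = 4^-1 * (p1 - p2) by rewrite ra; field.
have -> : inner b1 b2 = 4^-1 * (p3 - p4) by rewrite rb; field.
have -> : inner (M *m x) eta + inner (M *m y) xi = 2^-1 * (p5 - p6) by rewrite rm; field.
have c4 : (4^-1 : R[i]) = (4^-1 : R)%:C%C by rewrite fmorphV rmorph_nat.
by rewrite c4; apply/eqP; rewrite eq_complex /=; apply/andP; split; apply/eqP; field.
Qed.

(** * Vanishing of the singular space *)

Theorem mainTheorem11 (R : realType) (n : nat) (Q B : 'M[R]_n)
    (hn : (0 < n)%N)
    (hQ : sym_psd Q)
    (hKalman : kalman_rank Q B)
    (hspec : spectrum_in_left_half_plane B) :
  singular_space (OU_form Q B) = [set 0].
Proof.
have [Spsd SS] := sqrt_mxP hn hKalman.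
have [X hX] := sylvester_surj (- Q) hspec.
have [Xs QX] := Q_inftyE hQ hspec hX.
have Xu := lyapunov_solution_unit hn hKalman Xs hX.
pose K := invmx X; pose M := 2^-1 *: (Q *m K) + B; have [Qs _] := hQ.
have Ks : K^T = K by rewrite /K trmx_inv Xs.
(* Written in the shape required by [output_injection], with [L = K / 2]. *)
pose A := 2^-1 *: (B^T + (2^-1 *: K) *m Q).
have MT : 2^-1 *: M^T = A.
  by rewrite /A /M linearD linearZ /= trmx_mul Ks Qs addrC scalemxAl.
(* The Lyapunov equation multiplied by [K] on both sides. *)
have KB : K *m B = - (K *m Q *m K) - B^T *m K.
  have := congr1 (fun Y => K *m Y *m K) hX.
  rewrite mulmxDr mulmxDl !mulmxA mulVmx // mul1mx -(mulmxA _ X K) mulmxV // mulmx1.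
  by rewrite mulmxN mulNmx => <-; rewrite addrK.
have KM : K *m (- 2^-1 *: M) = A *m K.
  rewrite -scalemxAr /M mulmxDr KB /A -scalemxAl mulmxDl -!scalemxAl -scalemxAr !mulmxA.
  by rewrite scaleNr -scalerN; congr (_ *: _); apply/matrixP => i j; rewrite !mxE; field.
have KMj j (x : 'cV[R]_n) : K *m ((- 2^-1 *: M) ^+ j *m x) = A ^+ j *m (K *m x).
  elim: j x => [|j IH] x; first by rewrite !expr0 !mul1mx.
  by rewrite !exprSr -!mulmxE -!mulmxA IH (mulmxA K) KM -!mulmxA.
have Imj j : OU_Im M ^+ j = block_mx ((- 2^-1 *: M) ^+ j) 0 0 (A ^+ j).
  elim: j => [|j IH]; first by rewrite !expr0 [LHS]scalar_mx_block.
  by rewrite !exprS -!mulmxE IH /OU_Im MT mulmx_block !mul0mx !mulmx0 !addr0 !add0r.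
have obs (v : 'cV[R]_n) : (forall j, (j < n)%N -> Q *m (A ^+ j *m v) = 0) -> v = 0.
  move=> hv; apply: (kalman_observable hn hKalman).
  by apply: (output_injection _ hv); rewrite invr_neq0 // pnatr_eq0.
rewrite /singular_space OU_hamilton_map // QX; apply/seteqP; split=> Z; last first.
  by move=> -> j _ /=; rewrite complexifyE map_mx0 mulmx0.
move=> hZ.
(* [Re F], [Im F] and [Z] are complexifications, so the kernel conditions descend to real
   equations. *)
have real j : (j < n)%N -> OU_Re Q K *m (OU_Im M ^+ j *m Z) = 0.
  move=> jn; have := hZ j (leq_trans jn (leq_addr _ _)); rewrite /= Re_mx_of_parts Im_mx_of_parts.
  rewrite -complexifyX -!complexifyM mulmxA => h; apply/matrixP => k l.
  by have /matrixP/(_ k l) := h; rewrite !mxE => -[].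
have parts j : (j < n)%N -> Q *m (A ^+ j *m dsubmx Z) = 0 /\
    Q *m (A ^+ j *m (K *m usubmx Z)) = 0.
  move=> /real; rewrite Imj -{1}[Z]vsubmxK !mul_block_col !mul0mx !add0r !addr0 -col_mx0.
  move=> /eq_col_mx[]; rewrite -!scalemxAl => /eqP + /eqP.
  rewrite !scaler_eq0 oppr_eq0 !invr_eq0 !pnatr_eq0 /= => /eqP h1 /eqP h2; split => //.
  (* The lower block gives this equation; the outer [K] is cancelled by [X], and the inner one is
     moved past the power by [KMj]. *)
  rewrite -KMj; have : K *m (Q *m (K *m ((- 2^-1 *: M) ^+ j *m usubmx Z))) = 0.
    by rewrite -h2 Ks !mulmxA.
  by move=> /(congr1 (mulmx X)); rewrite mulmxA mulmxV // mul1mx mulmx0.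
rewrite -[Z]vsubmxK (obs (dsubmx Z)); last by move=> j /parts[].
have Ku : K *m usubmx Z = 0 by apply: obs => j /parts[].
have := congr1 (mulmx X) Ku; rewrite mulmxA mulmxV // mul1mx mulmx0 => ->.
exact: col_mx0.
Qed.
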